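(* For every positive integer $n$, $$\operatorname{st}_{+}\big(A(1,2,\ldots,n)\big)\le 2\lceil \log_2 n\rceil .$$
   Context: For real numbers $x_1,\ldots,x_n$, the associated Euclidean distance matrix is the $n\times n$ symmetric nonnegative matrix $A(x_1,\ldots,x_n):=\big(|x_i-x_j|^2\big)_{i,j=1}^n$; in particular $A(1,\ldots,n)=\big((i-j)^2\big)_{i,j=1}^n$. Here $\mathbb{R}_{+}^{m\times n}$ is the set of $m\times n$ real matrices with nonnegative entries and $\mathcal{S}_n^{+}$ is the set of symmetric $n\times n$ matrices with nonnegative entries. For $A\in\mathcal{S}_n^{+}$, an SN-Trifactorization of $A$ is a factorization $A=BCB^{T}$ with $B\in\mathbb{R}_{+}^{n\times k}$ and $C\in\mathcal{S}_k^{+}$; the SNT-rank $\operatorname{st}_{+}(A)$ is the smallest integer $k$ for which such a factorization exists, with the convention $\operatorname{st}_{+}(0)=0$. *)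

(* Defs.v *)
From HB Require Import structures.
From mathcomp Require Import all_boot all_order all_algebra.
From mathcomp Require Import all_classical all_reals all_analysis.

Set Implicit Arguments.
Unset Strict Implicit.
Unset Printing Implicit Defensive.

Import Order.TTheory GRing.Theory Num.Theory.

Local Open Scope ring_scope.

Definition edm (R : realType) (n : nat) (x : 'I_n -> R) : 'M[R]_n :=
  \matrix_(i, j) `|x i - x j| ^+ 2.

Definition symnneg (R : realType) (n : nat) (A : 'M[R]_n) : Prop :=
  A^T = A /\ A \is a mxOver Num.nneg.

Definition sn_trifactorization (R : realType) (n k : nat)
    (A : 'M[R]_n) (B : 'M[R]_(n, k)) (C : 'M[R]_k) : Prop :=
  [/\ B \is a mxOver Num.nneg, symnneg C & A = B *m C *m B^T].

Definition has_sn_trifactorization (R : realType) (n : nat)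
    (A : 'M[R]_n) (k : nat) : Prop :=
  exists (B : 'M[R]_(n, k)) (C : 'M[R]_k), sn_trifactorization A B C.

(* The value 0 is a default outside of symnneg only: see snt_rankP. The
   convention that the zero matrix has rank 0 comes from allowing k = 0, with
   empty B and C: see snt_rank0. *)
Definition snt_rank (R : realType) (n : nat) (A : 'M[R]_n) : nat :=
  match pselect (exists k, `[< has_sn_trifactorization A k >]) with
  | left exk => ex_minn exk
  | right _ => 0%N
  end.

Lemma edm_symnneg (R : realType) (n : nat) (x : 'I_n -> R) : symnneg (edm x).
Proof.
split; first by apply/matrixP => i j; rewrite !mxE distrC.
by apply/mxOverP => i j; rewrite mxE nnegrE exprn_ge0.
Qed.

Lemma snt_rankP (R : realType) (n : nat) (A : 'M[R]_n) : symnneg A ->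
  has_sn_trifactorization A (snt_rank A) /\
  forall k, has_sn_trifactorization A k -> (snt_rank A <= k)%N.
Proof.
move=> snA; rewrite /snt_rank; case: pselect => [exk|[]].
  case: ex_minnP => m /asboolP hm minm; split=> // k hk.
  by apply: minm; apply/asboolP.
exists n; apply/asboolP; exists 1%:M, A; split=> //.
  apply/mxOverP => i j; rewrite mxE nnegrE; exact: ler0n.
by rewrite mul1mx trmx1 mulmx1.
Qed.

Lemma snt_rank0 (R : realType) (n : nat) : snt_rank (0 : 'M[R]_n) = 0%N.
Proof.
have sn0 m : symnneg (0 : 'M[R]_m).
  by split; [rewrite trmx0 | apply/mxOverP => i j; rewrite mxE nnegrE].
apply/eqP; rewrite -leqn0; apply: (proj2 (snt_rankP (sn0 n))).
exists 0, 0; split; [exact: thinmxOver | exact: sn0 | by rewrite !mul0mx].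
Qed.

(* Main.v *)
(* Centre the 2 ^ m.+1 points at 0 and write a point as s * a with s a sign and
   a >= 0.  Then |s a - t b|^2 is |a - b|^2 when s = t, and |a - b|^2 + 4ab
   otherwise.  The correction term is u v^T + v u^T, where u and v are the
   vector of the 2a's restricted to the positive and to the negative points: it
   has an SN-trifactorization of size 2.  The absolute values a are again
   equally spaced, and take only 2 ^ m values, so that 2m columns suffice for
   2 ^ m points by induction; for other n, round up to a power of 2. *)

Require Import Defs.
From HB Require Import structures.
From mathcomp Require Import all_boot all_order all_algebra.
From mathcomp Require Import all_classical all_reals all_analysis.
From mathcomp Require Import zify ring.

Set Implicit Arguments.
Unset Strict Implicit.
Unset Printing Implicit Defensive.

Import Order.TTheory GRing.Theory Num.Theory.

Local Open Scope ring_scope.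

Lemma row_mx_nneg (R : realType) (m n1 n2 : nat)
    (A : 'M[R]_(m, n1)) (B : 'M[R]_(m, n2)) :
  A \is a mxOver Num.nneg -> B \is a mxOver Num.nneg ->
  row_mx A B \is a mxOver Num.nneg.
Proof.
move=> /mxOverP hA /mxOverP hB; apply/mxOverP => i j.
by rewrite mxE; case: splitP.
Qed.

Lemma block_mx_nneg (R : realType) (m1 m2 n1 n2 : nat)
    (A : 'M[R]_(m1, n1)) (B : 'M[R]_(m1, n2))
    (C : 'M[R]_(m2, n1)) (D : 'M[R]_(m2, n2)) :
  A \is a mxOver Num.nneg -> B \is a mxOver Num.nneg ->
  C \is a mxOver Num.nneg -> D \is a mxOver Num.nneg ->
  block_mx A B C D \is a mxOver Num.nneg.
Proof.
move=> hA hB hC hD; apply/mxOverP => i j; rewrite mxE.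
by case: splitP => k _; [have /mxOverP := row_mx_nneg hA hB
                        |have /mxOverP := row_mx_nneg hC hD].
Qed.

Lemma mx0_nneg (R : realType) (m n : nat) :
  (0 : 'M[R]_(m, n)) \is a mxOver Num.nneg.
Proof. by apply/mxOverP => i j; rewrite mxE nnegrE. Qed.

(** A block-diagonal middle factor leaves no mixed products, so the sizes add. *)
Lemma has_sn_trifactorization_add (R : realType) (n k l : nat)
    (A A' : 'M[R]_n) :
  has_sn_trifactorization A k -> has_sn_trifactorization A' l ->
  has_sn_trifactorization (A + A') (k + l).
Proof.
move=> [B [C [hB [symC hC] ->]]] [B' [C' [hB' [symC' hC'] ->]]].
exists (row_mx B B'), (block_mx C 0 0 C'); split.
- exact: row_mx_nneg.
- split; first by rewrite tr_block_mx symC symC' !trmx0.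
  by apply: block_mx_nneg => //; exact: mx0_nneg.
- by rewrite mul_row_block !mulmx0 addr0 add0r tr_row_mx mul_row_col.
Qed.

(** The middle factor is the 2 by 2 exchange matrix, which pairs each column with the other. *)
Lemma has_sn_trifactorization_cross (R : realType) (n : nat) (u v : 'cV[R]_n) :
  u \is a mxOver Num.nneg -> v \is a mxOver Num.nneg ->
  has_sn_trifactorization (u *m v^T + v *m u^T) (1 + 1).
Proof.
move=> hu hv; exists (row_mx u v), (block_mx 0 1%:M 1%:M 0); split.
- exact: row_mx_nneg.
- split; first by rewrite tr_block_mx trmx1 !trmx0.
  have h1 : (1%:M : 'M[R]_1) \is a mxOver Num.nneg.
    by apply/mxOverP => i j; rewrite mxE nnegrE ler0n.
  by apply: block_mx_nneg => //; exact: mx0_nneg.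
- rewrite mul_row_block !mulmx0 !mulmx1 addr0 add0r tr_row_mx mul_row_col.
  exact: addrC.
Qed.

(** Repeated values of [p] are allowed because folding merges points: the induction keeps [n] fixed
    and lowers only [m]. *)
Lemma has_sn_trifactorization_edm_nat (R : realType) (n m : nat)
    (p : 'I_n -> nat) : (forall i, p i < 2 ^ m)%N ->
  has_sn_trifactorization (edm (fun i => (p i)%:R : R)) (2 * m).
Proof.
elim: m p => [|m IH] p hp.
  exists 0, 0; split; [exact: mx0_nneg | split; [exact: trmx0 | exact: mx0_nneg]|].
  apply/matrixP => i j; rewrite !mul0mx !mxE.
  have := hp i; have := hp j; rewrite expn0 !ltnS !leqn0 => /eqP -> /eqP ->.
  by rewrite subrr normr0 expr0n.
(* The folding a = q + 1/2 of the points p centred at 2 ^ m - 1/2; the entries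
   of w are 2a, so that their products are 4ab. *)
pose q i := (if p i < 2 ^ m then 2 ^ m - (p i).+1 else p i - 2 ^ m)%N.
have hq i : (q i < 2 ^ m)%N.
  by have := hp i; rewrite /q expnS; case: ifP; lia.
pose w (b : bool) : 'cV[R]_n :=
  \col_i (if (p i < 2 ^ m)%N == b then 2 * (q i)%:R + 1 else 0).
have hw b : w b \is a mxOver Num.nneg.
  by apply/mxOverP => i j; rewrite mxE nnegrE; case: ifP => // _;
    rewrite addr_ge0 ?mulr_ge0.
have -> : edm (fun i => (p i)%:R : R) =
    edm (fun i => (q i)%:R) + (w true *m (w false)^T + w false *m (w true)^T).
  apply/matrixP => i j; rewrite !mxE !big_ord1 !mxE !real_normK ?num_real //.
  have foldE k : (p k)%:R = if (p k < 2 ^ m)%N then (2 ^ m)%:R - 1 - (q k)%:R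
                            else (2 ^ m)%:R + (q k)%:R :> R.
    rewrite /q; case: ltnP => hk.
      by rewrite natrB // -natr1; ring.
    by rewrite natrB //; ring.
  rewrite (foldE i) (foldE j).
  (* On opposite sides the distance is [q i + q j + 1], whose square exceeds that of [q i - q j] by
     [(2 * q i + 1) * (2 * q j + 1)]. *)
  by case: (p i < _)%N; case: (p j < _)%N => /=; ring.
rewrite mulnS addnC.
exact: has_sn_trifactorization_add (IH q hq) (has_sn_trifactorization_cross _ _).
Qed.

(** As [n] is at least 1, the logarithm is nonnegative and its ceiling is a natural number. *)
Lemma leq_exp2_ceil_log (R : realType) (n : nat) : (0 < n)%N ->
  exists2 m : nat, (n <= 2 ^ m)%N & m%:Z = Num.ceil (ln (n%:R : R) / ln 2).
Proof.
move=> n_gt0; have ln2_gt0 : 0 < ln 2 :> R by rewrite ln_gt0 ?ltr1n.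
set x := _ / _; have x_ge0 : 0 <= x.
  by rewrite divr_ge0 ?(ltW ln2_gt0) // ln_ge0 // ler1n.
have /gez0_abs cE : 0 <= Num.ceil x.
  by rewrite -(ler_int R) (le_trans x_ge0) ?ceil_ge.
exists `|Num.ceil x|%N => //.
have : x <= (`|Num.ceil x|%N)%:R by rewrite -[_%:R]/(_%:Z%:~R) cE ceil_ge.
rewrite ler_pdivrMr // mulr_natl -lnXn // ler_ln ?posrE ?ltr0n ?exprn_gt0 //.
by rewrite -natrX ler_nat.
Qed.

Theorem theorem1p1 (R : realType) (n : nat) (n_gt0 : (0 < n)%N) :
  (snt_rank (edm (fun i : 'I_n => i.+1%:R : R)))%:Z
    <= 2 * Num.ceil (ln (n%:R : R) / ln 2).
Proof.
have [m le_n <-] := leq_exp2_ceil_log R n_gt0.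
(* Distances are translation invariant; starting at 0 keeps every point strictly below [2 ^ m], even
   when [n = 2 ^ m]. *)
have -> : edm (fun i : 'I_n => i.+1%:R : R) = edm (fun i => (i : nat)%:R).
  by apply/matrixP => i j; rewrite !mxE -!natr1 opprD addrACA subrr addr0.
rewrite -[2]/(2%:Z) -PoszM lez_nat.
apply: (proj2 (snt_rankP (edm_symnneg _))).
apply: has_sn_trifactorization_edm_nat => i.
exact: leq_trans (ltn_ord i) le_n.
Qed.
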